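(* For general permutations $\sigma$ of a finite set $X=\{1,\dots,n\}$, the permutation Jones polynomial $J_\sigma$ is not determined by the Jones polynomial.
   Context: Diagrams are oriented link diagrams in the plane with classical crossings and possibly virtual crossings. Virtual knots and links are such diagrams up to the classical Reidemeister moves I, II, III, the purely virtual moves I, II, III, and the mixed virtual move (a strand having only virtual crossings with the others is moved past a classical crossing). $J_\sigma$ is an invariant of oriented classical and virtual knots and links; $J_\sigma(L)$ is computed from any diagram $D$ of $L$ and does not depend on the diagram chosen. Colorings. A semiarc of $D$ is an edge of the graph obtained by regarding the classical crossing points as vertices (virtual crossings are ignored; a component with no classical crossing is a single semiarc). A $\sigma$-coloring of $D$ assigns an element of $X$ to each semiarc such that at each classical crossing of sign $\epsilon\in\{+1,-1\}$: if the incoming semiarc of the under-strand has color $x$, its outgoing semiarc has color $\sigma^{\epsilon}(x)$; if the incoming semiarc of the over-strand has color $y$, its outgoing semiarc has color $\sigma^{-\epsilon}(y)$. $\mathcal{C}_\sigma(D)$ is the set of $\sigma$-colorings of $D$. Monochromatic crossings. Draw a crossing with both strands oriented upward. It is monochromatic if the two semiarcs on its left side (one incoming, one outgoing, belonging to different strands) have equal colors, and polychromatic otherwise. (For a positive crossing the left semiarcs are the incoming over-semiarc and the outgoing under-semiarc; for a negative crossing they are the incoming under-semiarc and the outgoing over-semiarc.) States. A Kauffman state $s$ of a $\sigma$-colored diagram $d$ is obtained by replacing each monochromatic crossing by one of its two smoothings and each polychromatic crossing by a virtual crossing. A positive monochromatic crossing contributes a factor $a$ for the smoothing compatible with the orientation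 and $b$ for the other smoothing; a negative monochromatic crossing contributes $a^{-1}$ for the orientation-compatible smoothing and $b^{-1}$ for the other; a polychromatic crossing of sign $\epsilon$ contributes $v^{\epsilon}$. The product of these factors is the monomial $a^xb^yv^z$ of $s$; $|s|$ is the number of closed curves in $s$ (which may cross virtually); $\mathcal S(d)$ is the set of Kauffman states of $d$. The permutation Jones polynomial is the Laurent polynomial in $a,b,v$ with integer coefficients $$J_\sigma(L)=\sum_{d\in\mathcal C_\sigma(D)}(-a^2b^{-1})^{-\mathrm{writhe}(D)}\sum_{s\in\mathcal S(d)}a^xb^yv^z(-ab^{-1}-ba^{-1})^{|s|},$$ where $\mathrm{writhe}(D)$ is the sum of the signs of the classical crossings of $D$. The Jones polynomial (in Kauffman bracket form) of $L$ is obtained from $J_{[1]}(L)$, where $[1]$ is the unique permutation of $\{1\}$, by setting $b=a^{-1}$ and dividing by $-a^2-a^{-2}$ (so that the unknot has value $1$). *)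

(* Defs.v *)
From mathcomp Require Import all_boot all_order all_algebra all_fingroup.
From mathcomp Require Import mpoly.

Set Implicit Arguments.
Unset Strict Implicit.
Unset Printing Implicit Defensive.

Import GRing.Theory.
Local Open Scope ring_scope.

(** Oriented link diagrams are 4-valent plane graphs, encoded by rotation
    systems.  Every crossing is drawn with both strands oriented upward, so that
    it has two incoming ends (bottom) and two outgoing ends (top), each of them
    on the left or on the right.  The strand entering on one side leaves on the
    other one.  A pair [(c, t) : crossing * bool] stands for the side [t] of the
    crossing [c], where [true] is left and [false] is right. *)

Variant crossing_kind := Positive | Negative | Virtual.

(** [arc] maps the outgoing end at which an edge starts to the incoming end at
    which that edge arrives; edges are thus identified with outgoing ends.
    [circles] counts the components that meet no crossing, not even a virtual
    one. *)
Record diagram_code := DiagramCode {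
  crossing : finType;
  kind : crossing -> crossing_kind;
  arc : {perm crossing * bool};
  circles : nat
}.

Section Diagrams.

Variable D : diagram_code.
Local Notation C := (crossing D).

(** An end of an edge at a crossing: [(c, t, true)] is the outgoing and
    [(c, t, false)] the incoming end on the side [t] of [c]. *)
Definition dart : Type := (C * bool * bool)%type.

Definition mate (d : dart) : dart :=
  let: (x, out) := d in
  if out then (arc D x, false) else (((arc D)^-1)%g x, true).

(** The next end counterclockwise around the crossing:
    top right, top left, bottom left, bottom right. *)
Definition rot_ccw (d : dart) : dart :=
  match d with
  | (c, false, true) => (c, true, true)
  | (c, true, true) => (c, true, false)
  | (c, true, false) => (c, false, false)
  | (c, false, false) => (c, false, true)
  end.

Definition face_next (d : dart) : dart := rot_ccw (mate d).

Definition adjacent : rel dart :=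
  [rel d d' | (d' == mate d) || (d' == rot_ccw d)].

(** Euler's formula V + F = E + 2 (number of connected components). *)
Definition planar : bool :=
  (#|C| + fcard face_next predT ==
     #|{: C * bool}| + (n_comp adjacent predT).*2)%N.

(** Virtual crossings get sign 0: all factors attached to a crossing of sign
    [e] below are [e]-th powers, hence trivial at virtual crossings. *)
Definition sgn (c : C) : int :=
  match kind c with Positive => 1 | Negative => -1 | Virtual => 0 end.

Definition classical (c : C) : bool :=
  match kind c with Virtual => false | _ => true end.

Definition writhe : int := \sum_(c : C) sgn c.

(** The side on which the over-strand enters, which is also the side on which
    the under-strand leaves (no meaning at virtual crossings). *)
Definition over_side (c : C) : bool :=
  match kind c with Positive => true | _ => false end.

Section Colorings.

Variables (n : nat) (s : {perm 'I_n}).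

Definition perm_expz (e : int) : {perm 'I_n} :=
  match e with Posz k => (s ^+ k)%g | Negz k => (s ^- k.+1)%g end.

(** A color for every edge and one for every crossingless circle. *)
Definition edge_coloring : Type :=
  ({ffun C * bool -> 'I_n} * {ffun 'I_(circles D) -> 'I_n})%type.

Definition out_color (f : edge_coloring) (c : C) (t : bool) : 'I_n := f.1 (c, t).
Definition in_color (f : edge_coloring) (c : C) (t : bool) : 'I_n :=
  f.1 (((arc D)^-1)%g (c, t)).

(** At a virtual crossing the sign is 0 and both conditions say that the color
    is unchanged along the strand, i.e. that [f] is constant on semiarcs. *)
Definition is_coloring (f : edge_coloring) : bool :=
  [forall c : C,
     let o := over_side c in
     let u := ~~ o in
     (out_color f c (~~ u) == perm_expz (sgn c) (in_color f c u)) &&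
     (out_color f c (~~ o) == perm_expz (- sgn c) (in_color f c o))].

Definition monochromatic (f : edge_coloring) : {set C} :=
  [set c | classical c & in_color f c true == out_color f c true].

End Colorings.

(** A Kauffman state is given by the set [M] of smoothed crossings and the
    subset [S] of those smoothed against the orientation.  [join M S] is the
    end to which an end is connected inside its crossing. *)
Definition join (M S : {set C}) (d : dart) : dart :=
  let: (c, t, out) := d in
  if c \in M then
    if c \in S then (c, ~~ t, out) else (c, t, ~~ out)
  else (c, ~~ t, ~~ out).

Definition curves (M S : {set C}) : nat :=
  (n_comp [rel d d' : dart | (d' == mate d) || (d' == join M S d)] predT
     + circles D)%N.

Section StateSum.

Variables (K : fieldType) (a b v : K).

Definition factor (M S : {set C}) (c : C) : K :=
  (if c \in M then if c \in S then b else a else v) ^ sgn c.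

Definition state_sum (n : nat) (s : {perm 'I_n}) : K :=
  \sum_(f : edge_coloring n | is_coloring s f)
    (- a ^+ 2 * b^-1) ^ (- writhe) *
    \sum_(S in powerset (monochromatic f))
      (\prod_(c : C) factor (monochromatic f) S c) *
      (- (a * b^-1) - b * a^-1) ^+ curves (monochromatic f) S.

End StateSum.

End Diagrams.

Record link_diagram := LinkDiagram {
  code :> diagram_code;
  code_planar : planar code
}.

(** Integral Laurent polynomials in a, b, v are taken in the field of fractions
    of Z[a, b, v], which contains them. *)
Definition ratfun : fieldType := {fraction {mpoly int[3]}}.

Definition indet (i : 'I_3) : ratfun := tofrac ('X_i : {mpoly int[3]}).
Definition var_a : ratfun := indet (inord 0).
Definition var_b : ratfun := indet (inord 1).
Definition var_v : ratfun := indet (inord 2).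

Definition permutation_jones (n : nat) (s : {perm 'I_n}) (D : link_diagram) :
    ratfun :=
  state_sum D var_a var_b var_v s.

(** The substitution b = a^-1 is made in the defining state sum, because
    substitution is not a total operation on fractions. *)
Definition jones (D : link_diagram) : ratfun :=
  state_sum D var_a var_a^-1 var_v (1%g : {perm 'I_1})
    / (- var_a ^+ 2 - var_a ^- 2).

(* Main.v *)
Require Import Defs.
From mathcomp Require Import all_boot all_order all_algebra all_fingroup.
From mathcomp Require Import mpoly ring.

(** Close up the two-strand braid with four crossings: the word
    "positive, positive, virtual, virtual" gives the Hopf link and the word
    "positive, virtual, positive, virtual" the link obtained from it by
    reversing one arrow of the Gauss diagram.  A state of such a closure with
    [m] smoothed crossings, [k] of them against the orientation, has [k] curves
    if [k > 0], and otherwise one or two according to the parity of [m]; so its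
    contribution only depends on [m] and [k], and the Jones polynomials agree.
    In the second link one component passes over at both classical crossings,
    so its colors would have to be fixed by [sigma^2]; for a 3-cycle there are
    none and the invariant vanishes.  The Hopf link has colorings, and after
    clearing denominators each of them contributes 4 at [a = b = 1], [v = -1]. *)

Set Implicit Arguments.
Unset Strict Implicit.
Unset Printing Implicit Defensive.

Import GRing.Theory.

(** * Counting connected components by computation *)

Section ComputeComponents.

Variables (T : finType) (L : seq T) (f g : T -> T).

Definition reach (x : T) : seq T :=
  dfs (fun y => [:: f y; g y]) (size L) [::] x.

(** Unlike the root chosen by [fingraph], this representative can be evaluated on an explicit list
    [L]. *)
Definition component_rep (x : T) : T :=
  let s := reach x in head x [seq y <- L | y \in s].

Hypotheses (L_uniq : uniq L) (L_full : forall x, x \in L).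

Lemma card_count (A : {pred T}) : #|A| = count (mem A) L.
Proof.
rewrite -size_filter cardE; apply: perm_size; apply: uniq_perm.
- exact: enum_uniq.
- exact: filter_uniq.
- by move=> x; rewrite mem_enum mem_filter L_full andbT.
Qed.

Variable e : rel T.
Hypothesis eE : forall x y, e x y = (y == f x) || (y == g x).

Lemma mem_reach x y : (y \in reach x) = connect e x y.
Proof.
rewrite /reach -(count_predT L) -card_count.
apply/dfsP/connectP=> -[p e_p ->]; exists p => //; move: e_p;
  by rewrite (eq_path (e' := e)) // => u w; rewrite eE /= !inE.
Qed.

Hypotheses (f_inj : injective f) (g_inj : injective g).

(** An injective map of a finite type is a permutation, so iterating it leads back along each of its
    own steps. *)
Lemma connect_inj_sym : connect_sym e.
Proof.
have back h : injective h -> (forall x, e x (h x)) ->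
    forall x, connect e (h x) x.
  move=> h_inj eh x.
  have sub : subrel (frel h) (connect e) by move=> u _ /eqP<-; apply: connect1.
  by apply: (connect_sub sub); rewrite (fconnect_sym h_inj) fconnect1.
have e_back x y : e x y -> connect e y x.
  by rewrite eE => /orP[]/eqP->; apply: back => // z; rewrite eE eqxx ?orbT.
suff sym x y : connect e x y -> connect e y x.
  by move=> x y; apply/idP/idP => /sym.
case/connectP=> p; elim: p x => [|z p IHp] x /= => [_ -> //|].
by case/andP=> /e_back zx /IHp{}IHp /IHp yz; apply: connect_trans yz zx.
Qed.

Lemma n_comp_count : n_comp e predT = count (fun x => component_rep x == x) L.
Proof.
set r := component_rep.
have rC x : connect e x (r x).
  rewrite /r /component_rep; set s := [seq _ <- _ | _].
  case def_s: s => [|y s'] //=; have: y \in s by rewrite def_s mem_head.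
  by rewrite mem_filter mem_reach => /andP[].
have rE x y : connect e x y = (r x == r y).
  apply/idP/eqP=> [xy|rxy].
    rewrite /r /component_rep; set s := [seq _ <- _ | _].
    rewrite -(_ : s = [seq z <- L | z \in reach y]); last first.
      apply: eq_filter => z; rewrite !mem_reach.
      by rewrite (same_connect connect_inj_sym xy).
    suff: x \in s by case: s.
    by rewrite mem_filter mem_reach connect0 L_full.
  by apply: connect_trans (rC x) _; rewrite rxy connect_inj_sym.
have -> : count (fun x => r x == x) L = #|[pred x | r x == x]|.
  by rewrite card_count.
(* [r] restricts to a bijection from the [fingraph] roots onto the fixed points of [r]. *)
rewrite /n_comp_mem -(card_in_imset (f := r) (D := [predI roots e & predT])).
  apply: eq_card => x; rewrite !inE; apply/imsetP/eqP=> [[y _ ->] | rx].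
    by apply/esym/eqP; rewrite -rE.
  exists (fingraph.root e x).
    by rewrite !inE /= (roots_root connect_inj_sym).
  by apply/esym/eqP; rewrite -[X in _ == X]rx -rE connect_inj_sym connect_root.
move=> x y; rewrite !inE !andbT => /eqP rx /eqP ry rxy; rewrite -rx -ry.
by apply/eqP; rewrite (root_connect connect_inj_sym) rE rxy.
Qed.

End ComputeComponents.

(** * Closures of two-strand braids with four crossings *)

Local Open Scope ring_scope.

(** The four crossings are numbered cyclically in binary. *)
Definition next4 (c : bool * bool) : bool * bool := (c.1 (+) c.2, ~~ c.2).
Definition prev4 (c : bool * bool) : bool * bool := (c.1 (+) ~~ c.2, ~~ c.2).

Lemma next4K : cancel next4 prev4. Proof. by case=> [[] []]. Qed.
Lemma prev4K : cancel prev4 next4. Proof. by case=> [[] []]. Qed.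

Definition next_end (x : bool * bool * bool) : bool * bool * bool :=
  (next4 x.1, x.2).

Lemma next_end_inj : injective next_end.
Proof.
by apply: (can_inj (g := fun x => (prev4 x.1, x.2))) => -[c t]; rewrite /= next4K.
Qed.

Definition braid_closure (p : pred (bool * bool)) : diagram_code :=
  DiagramCode (fun c => if p c then Positive else Virtual)
    (perm next_end_inj) 0.

Definition bools := [:: true; false].
Definition crossings4 := [seq (i, j) | i <- bools, j <- bools].
Definition darts4 : seq (bool * bool * bool * bool) :=
  [seq (x, o) | x <- [seq (c, t) | c <- crossings4, t <- bools], o <- bools].

Lemma crossings4_full c : c \in crossings4. Proof. by case: c => [[] []]. Qed.
Lemma darts4_full d : d \in darts4. Proof. by case: d => [[[[] []] []] []]. Qed.

Definition mate4 (d : bool * bool * bool * bool) : bool * bool * bool * bool :=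
  let: (c, t, out) := d in
  if out then (next4 c, t, false) else (prev4 c, t, true).

Definition join4 (m s : pred (bool * bool)) (d : bool * bool * bool * bool) :=
  let: (c, t, out) := d in
  if m c then if s c then (c, ~~ t, out) else (c, t, ~~ out)
  else (c, ~~ t, ~~ out).

Lemma mate4_inj : injective mate4.
Proof. by apply: inv_inj => -[[[[] []] []] []]. Qed.

Lemma join4_inj m s : injective (join4 m s).
Proof.
apply: inv_inj => -[[c t] o]; rewrite /join4.
by case m_c: (m c); case s_c: (s c); rewrite /= m_c ?s_c ?negbK.
Qed.

Section BraidClosure.

Variable p : pred (bool * bool).
Notation D := (braid_closure p).

Lemma arcE c t : Defs.arc D (c, t) = (next4 c, t).
Proof. by rewrite permE. Qed.

Lemma arcVE c t : ((Defs.arc D)^-1)%g (c, t) = (prev4 c, t).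
Proof. by rewrite -[in LHS](prev4K c) -arcE permK. Qed.

Lemma mateE : @mate D =1 mate4.
Proof. by move=> [[c t] []] /=; [rewrite -arcE | rewrite -arcVE]. Qed.

Definition rot4 : bool * bool * bool * bool -> bool * bool * bool * bool :=
  @rot_ccw D.

Lemma rot4_inj : injective rot4.
Proof.
by apply: (can_inj (g := rot4 \o rot4 \o rot4)) => -[[c []] []].
Qed.

Lemma planar_braid_closure : planar D.
Proof.
rewrite /planar.
(* Four bigons between consecutive crossings, and the faces inside and outside the closed braid. *)
have -> : fcard (@face_next D) predT = 6%N.
  have inj := inj_comp rot4_inj mate4_inj.
  rewrite (n_comp_count (L := darts4) _ darts4_full _ inj inj) //.
  by move=> x y; rewrite orbb /= /face_next mateE eq_sym.
have -> : n_comp (@adjacent D) predT = 1%N.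
  rewrite (n_comp_count (L := darts4) _ darts4_full _ mate4_inj rot4_inj) //.
  by move=> x y; rewrite -mateE.
by rewrite !card_prod card_bool.
Qed.

Definition braid_link : link_diagram := LinkDiagram planar_braid_closure.

(** Curves in a state with [m] smoothed crossings, [k] of them against the
    orientation. *)
Definition loops (m k : nat) : nat :=
  if k == 0%N then (~~ odd m).+1 else k.

(** If [S] is empty, the two strands swap at each of the [4 - m] unsmoothed crossings, so they close
    up to two curves exactly when [m] is even. Otherwise there is one curve between each smoothing
    in [S] and the cyclically next one. *)
Lemma curvesE (M S : {set crossing D}) :
  S \subset M -> curves M S = loops #|M| #|S|.
Proof.
move=> /subsetP sSM.
pose tab (A : {set bool * bool}) := [tuple (true, true) \in A;
   (true, false) \in A; (false, true) \in A; (false, false) \in A].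
pose fn (t : 4.-tuple bool) (c : bool * bool) :=
  nth false t ((~~ c.1).*2 + ~~ c.2).
have fnE (A : {set bool * bool}) c : (c \in A) = fn (tab A) c.
  by case: c => [[] []].
have cardE (A : {set bool * bool}) : #|A| = count (fn (tab A)) crossings4.
  by rewrite (card_count (L := crossings4) _ crossings4_full).
rewrite /curves addn0 !cardE.
have sub : all (fun c => fn (tab S) c ==> fn (tab M) c) crossings4.
  by apply/allP=> c _; apply/implyP; rewrite -!fnE; apply: sSM.
pose j := join4 (fn (tab M)) (fn (tab S)).
have eE (x y : dart D) :
    ((y == mate x) || (y == join M S x)) = (y == mate4 x) || (y == j x).
  rewrite mateE; congr (_ || (y == _)).
  by case: x => [[c t] o] /=; rewrite !fnE.
have j_inj : injective j by apply: join4_inj.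
rewrite (n_comp_count (L := darts4) _ darts4_full eE mate4_inj j_inj) //.
apply/eqP; move: sub; apply/implyP.
rewrite /j /fn /tab {j j_inj eE cardE fnE sSM fn tab}.
(* Only eight membership bits remain, which leaves a finite check. *)
do 4!move: (_ \in S); do 4!move: (_ \in M).
do 8!case; by vm_compute.
Qed.

End BraidClosure.

(** * State sums of the closures *)

Section StateSumClosure.

Variable p : pred (bool * bool).
Notation D := (braid_closure p).
Notation N := #|[set c : crossing D | p c]|.

Variables (K : fieldType) (a b v : K).

Definition state_term (N m : nat) : K :=
  (- a ^+ 2 * b^-1) ^- N *
  \sum_(k < m.+1) (a ^+ (m - k) * b ^+ k * v ^+ (N - m) *
    (- (a * b^-1) - b * a^-1) ^+ loops m k) *+ 'C(m, k).

Lemma writheE : writhe D = N%:Z.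
Proof.
rewrite /writhe (eq_bigr (fun c => (p c : nat)%:Z)); last first.
  by move=> c _; rewrite /sgn /=; case: (p c).
rewrite -(big_morph Posz PoszD erefl) -sum1_card big_mkcond /=; congr Posz.
by rewrite [in RHS]big_mkcond; apply: eq_bigr => c _; rewrite inE; case: (p c).
Qed.

Lemma prod_factor (M S : {set crossing D}) :
  S \subset M -> M \subset [set c | p c] ->
  \prod_(c : crossing D) factor a b v M S c =
    a ^+ (#|M| - #|S|) * b ^+ #|S| * v ^+ (N - #|M|).
Proof.
move=> sSM sMp; pose P := [set c : crossing D | p c].
(* The three sets partition the positive crossings; virtual ones contribute 1. *)
rewrite (eq_bigr (fun c => (if c \in M :\: S then a else 1) *
  (if c \in S then b else 1) * (if c \in P :\: M then v else 1))).
  rewrite !big_split /= -!big_mkcond /= !prodr_const !cardsD.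
  by rewrite (setIidPr sSM) (setIidPr sMp).
move=> c _; rewrite /factor /sgn /= !inE.
have := subsetP sMp c; have := subsetP sSM c; rewrite inE.
case: (c \in S) (c \in M) (p c) => [] [] [] SM Mp //=;
  rewrite ?mulr1 ?mul1r ?expr1z ?expr0z //.
- by have := Mp isT.
- by have := SM isT.
- by have := SM isT.
- by have := Mp isT.
Qed.

Lemma state_termE (M : {set crossing D}) : M \subset [set c | p c] ->
  (- a ^+ 2 * b^-1) ^ (- writhe D) *
    \sum_(S in powerset M) (\prod_(c : crossing D) factor a b v M S c) *
      (- (a * b^-1) - b * a^-1) ^+ curves M S = state_term N #|M|.
Proof.
move=> sMp; rewrite writheE -exprnN; congr (_ * _).
(* States are grouped by the size of [S]; [inord] is faithful because [S] lies in [M]. *)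
rewrite (partition_big (fun S : {set crossing D} => inord #|S| : 'I_#|M|.+1)
  xpredT) //=.
apply: eq_bigr => k _; rewrite -cards_draws -sumr_const.
apply: eq_big => S; rewrite ?inE.
  case sSM: (S \subset M) => //=.
  by rewrite -val_eqE /= inordK // ltnS subset_leq_card.
case/andP=> sSM /eqP<-; rewrite inordK ?ltnS ?subset_leq_card //.
by rewrite curvesE // prod_factor.
Qed.

Lemma monochromatic_sub n (f : edge_coloring D n) :
  monochromatic f \subset [set c | p c].
Proof. by apply/subsetP=> c; rewrite !inE /classical /=; case: (p c). Qed.

Lemma state_sumE n (s : {perm 'I_n}) :
  state_sum D a b v s = \sum_(f : edge_coloring D n | is_coloring s f)
    state_term N #|monochromatic f|.
Proof. by apply: eq_bigr => f _; apply/state_termE/monochromatic_sub. Qed.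

(** With one color there is a single coloring and every classical crossing is monochromatic. *)
Lemma state_sum_1 : state_sum D a b v (1%g : {perm 'I_1}) = state_term N N.
Proof.
rewrite state_sumE (eq_big xpredT (fun=> state_term N N)).
- by rewrite sumr_const card_prod !card_ffun !card_ord !exp1n.
- move=> f; apply/forallP=> c.
  by apply/andP; split; apply/eqP; rewrite [LHS]ord1 [RHS]ord1.
move=> f _; congr (state_term _ #|pred_of_set _|); apply/setP=> c.
rewrite !inE /classical /= (_ : (_ == _) = true) ?andbT; first by case: (p c).
by apply/eqP; rewrite [LHS]ord1 [RHS]ord1.
Qed.

End StateSumClosure.

(** * The two links and their colorings *)

Definition hopf := braid_link (fun c => ~~ c.1).
(** As [c.1] is the high bit, crossings 0 and 2 are positive here, 0 and 1 in [hopf]. *)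
Definition twisted_hopf := braid_link (fun c => ~~ c.2).

Lemma card_hopf : #|[set c : crossing hopf | ~~ c.1]| = 2%N.
Proof. by rewrite cardsE (card_count _ crossings4_full). Qed.

Lemma card_twisted_hopf : #|[set c : crossing twisted_hopf | ~~ c.2]| = 2%N.
Proof. by rewrite cardsE (card_count _ crossings4_full). Qed.

Lemma jones_hopf : jones hopf = jones twisted_hopf.
Proof. by rewrite /jones !state_sum_1 card_hopf card_twisted_hopf. Qed.

Lemma twisted_hopf_coloring n (s : {perm 'I_n})
    (f : edge_coloring twisted_hopf n) :
  is_coloring s f -> exists x, s (s x) = x.
Proof.
move/forallP=> col.
(* The second condition concerns the over-strand or, at a virtual crossing, the strand entering on
   the right; chained together, these follow one component all the way around. *)
have /andP[_ /eqP] := col (false, false).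
have /andP[_ /eqP] := col (false, true).
have /andP[_ /eqP] := col (true, false).
have /andP[_ /eqP] := col (true, true).
rewrite /out_color /in_color /= !(@arcVE (fun c => ~~ c.2)) /= /over_side /prev4 /=.
rewrite expg0 expg1 !perm1 => -> -> -> e.
by exists (f.1 (false, false, false)); rewrite {1}e !permKV.
Qed.

Lemma permutation_jones_twisted_hopf_eq0 n (s : {perm 'I_n}) :
  (forall x, s (s x) <> x) -> permutation_jones s twisted_hopf = 0.
Proof.
move=> s2_neq; rewrite /permutation_jones /state_sum big_pred0 // => f.
by apply/negP=> /twisted_hopf_coloring[x]; apply: s2_neq.
Qed.

Lemma hopf_colorable n (s : {perm 'I_n}) (x : 'I_n) :
  exists f : edge_coloring hopf n, is_coloring s f.
Proof.
(* Crossing 1 undoes the color changes of crossing 0, so only the two edges between them need colors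
   other than [x]. *)
pose col (e : bool * bool * bool) : 'I_n :=
  if e.1 == (false, false) then if e.2 then s x else (s^-1)%g x else x.
exists ([ffun e => col e], [ffun=> x]); apply/forallP=> -[[] []];
  rewrite /out_color /in_color /= !(@arcVE (fun c => ~~ c.1)) /= /over_side;
  rewrite /prev4 !ffunE /col /= ?expg0 ?perm1 ?eqxx //.
by rewrite expg1 permKV permK !eqxx.
Qed.

(** [a ^+ 6] times a state term of a diagram with two positive crossings. *)
Definition cleared_term (R : comNzRingType) (a b v : R) (m : nat) : R :=
  let w := a ^+ 2 + b ^+ 2 in
  match m with
  | 0 => v ^+ 2 * w ^+ 2
  | 1 => - (a * b * v * (a + b) * w)
  | _ => w ^+ 3 - a ^+ 2 * b ^+ 2 * w *+ 2
  end.

(** Serves both the embedding of polynomials into fractions and the evaluation at integers. *)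
Lemma rmorph_cleared_term (R R' : comNzRingType) (phi : {rmorphism R -> R'})
    (a b v : R) m :
  phi (cleared_term a b v m) = cleared_term (phi a) (phi b) (phi v) m.
Proof.
by case: m => [|[|m]];
  rewrite !(rmorphB, rmorphN, rmorphM, rmorphXn, rmorphD, rmorphMn).
Qed.

Lemma cleared_termE (K : fieldType) (a b v : K) m :
  a != 0 -> b != 0 -> (m <= 2)%N ->
  state_term a b v 2 m * a ^+ 6 = cleared_term a b v m.
Proof.
move=> a0 b0; case: m => [|[|[|//]]] _;
  rewrite /state_term /cleared_term !big_ord_recr big_ord0 /= ?binn ?bin0 ?bin1;
  rewrite /loops /=; field; rewrite a0 b0 oppr_eq0 expf_neq0 //.
Qed.

Lemma indet_neq0 i : indet i != 0.
Proof.
rewrite tofrac_eq0; apply/eqP => /(congr1 (meval (fun=> 1))).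
by rewrite mevalXU meval0.
Qed.

Lemma permutation_jones_hopf n (s : {perm 'I_n}) :
  (0 < n)%N -> permutation_jones s hopf != 0.
Proof.
move=> n_gt0; apply/eqP=> J0.
pose x i : {mpoly int[3]} := 'X_(inord i).
pose q m := cleared_term (x 0) (x 1) (x 2) m.
have qE m : (m <= 2)%N ->
    state_term var_a var_b var_v 2 m * var_a ^+ 6 = tofrac (q m).
  by move=> m2; rewrite cleared_termE ?indet_neq0 // rmorph_cleared_term.
pose P := \sum_(f : edge_coloring hopf n | is_coloring s f) q #|monochromatic f|.
(* The vanishing is moved from fractions to polynomials, where evaluation at a point is
   available. *)
have P0 : P = 0.
  apply/eqP; rewrite -tofrac_eq0; apply/eqP.
  rewrite -[RHS](mul0r (var_a ^+ 6)) -J0 /permutation_jones state_sumE.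
  rewrite card_hopf mulr_suml rmorph_sum.
  apply: eq_bigr => f _; rewrite qE // -card_hopf.
  exact/subset_leq_card/monochromatic_sub.
(* At v = -1 the values no longer depend on the number of monochromatic
   crossings, so they cannot cancel. *)
pose y (i : 'I_3) : int := if i == inord 2 then -1 else 1.
have qy m : meval y (q m) = 4.
  rewrite rmorph_cleared_term /x /= !mevalXU /y -!val_eqE /= !inordK //.
  by case: m => [|[|m]].
have /eqP := congr1 (meval y) P0.
rewrite meval0 rmorph_sum (eq_big (mem [set f | is_coloring s f]) (fun=> 4)).
- rewrite sumr_const Num.Theory.mulrn_eq0 orbF cards_eq0 => /eqP/setP.
  have [f colf] := hopf_colorable s (Ordinal n_gt0).
  by move=> /(_ f); rewrite !inE colf.
- by move=> f; rewrite -[RHS]/(f \in [set g | is_coloring s g]) inE.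
- by move=> f _; apply: qy.
Qed.

(** The 3-cycle is translation by 1 modulo 3, where 1 + 1 is not 0. *)
Lemma perm_addr1_neq (x : 'I_3) : perm (@addrI _ 1) (perm (@addrI _ 1) x) <> x.
Proof.
rewrite !permE addrA => /(congr1 (+%R^~ (- x))).
by rewrite addrK subrr.
Qed.

Theorem proposition11 :
  exists (n : nat) (s : {perm 'I_n}) (D D' : link_diagram),
    (0 < n)%N /\
    jones D = jones D' /\
    permutation_jones s D <> permutation_jones s D'.
Proof.
exists 3, (perm (addrI 1)), hopf, twisted_hopf.
split; [by [] | split; [exact: jones_hopf |]].
rewrite permutation_jones_twisted_hopf_eq0; last exact: perm_addr1_neq.
exact/eqP/permutation_jones_hopf.
Qed.
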